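(* Let $V$ be a finite vertex set with a fixed partition $V=V_1\cup\cdots\cup V_\Delta$, and let $G$ and $H$ be two simple graphs on $V$ without isolated vertices such that in each of them, for every $i$, the set of vertices of degree $i$ is exactly $V_i$, and such that $\mathcal{J}(G)=\mathcal{J}(H)$. Then $G$ can be transformed into $H$ by a finite sequence of restricted swap operations.
   Context: For a simple graph $G$ with maximum degree $\Delta$ and $V_i$ the set of its vertices of degree $i$, the joint degree matrix $\mathcal{J}(G)$ is the $\Delta\times\Delta$ matrix with $\mathcal{J}(G)_{ij}=|\{xy\in E(G): x\in V_i, y\in V_j\}|$ (so $\mathcal{J}(G)_{ii}$ is the number of edges with both endpoints of degree $i$). A swap $ac,bd\Rightarrow bc,ad$ applies to distinct vertices $a,b,c,d$ with $ac,bd\in E$ and $bc,ad\notin E$, and replaces the edge set $E$ by $(E\setminus\{ac,bd\})\cup\{bc,ad\}$. A restricted swap operation (RSO) is such a swap where additionally $a$ and $b$ have the same degree (i.e. $a,b\in V_i$ for some $i$). RSOs preserve the degree of every vertex and the joint degree matrix. *)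

(* Defs.v *)
From HB Require Import structures.
From mathcomp Require Import all_boot all_order all_algebra.

Set Implicit Arguments.
Unset Strict Implicit.
Unset Printing Implicit Defensive.

Record sgraph (T : finType) := SGraph {
  edges : {set {set T}};
  edges_card2 : [forall e in edges, #|e| == 2]
}.

HB.instance Definition _ (T : finType) := [isSub for @edges T].
HB.instance Definition _ (T : finType) := [Finite of sgraph T by <:].

Section SimpleGraphs.
Variable T : finType.
Implicit Types (G H : sgraph T) (a b c d x y : T) (i : nat).

Definition adj G x y : bool := [set x; y] \in edges G.

Definition deg G x : nat := #|[set y | adj G x y]|.

Definition deg_class G i : {set T} := [set x | deg G x == i].

(* Rows and columns are indexed from 0: the entry at (i, j) concerns the degrees
   i + 1 and j + 1. For Delta = the maximum degree of G this is the joint degree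
   matrix; a larger Delta only adds zero rows and columns. Edges are unordered
   pairs, so an edge inside one degree class is counted once. *)
Definition jdm (Delta : nat) G : 'M[nat]_Delta :=
  (\matrix_(i < Delta, j < Delta)
     #|[set e in edges G | [exists x, exists y,
          [&& e == [set x; y],
              x \in deg_class G i.+1 & y \in deg_class G j.+1]]]|)%R.

(* H is the result of the swap ac, bd => bc, ad in G. *)
Definition swap G a b c d H : bool :=
  [&& uniq [:: a; b; c; d],
      adj G a c, adj G b d, ~~ adj G b c, ~~ adj G a d &
      edges H == (edges G :\: [set [set a; c]; [set b; d]])
                   :|: [set [set b; c]; [set a; d]]].

Definition rso : rel (sgraph T) := fun G H =>
  [exists a, exists b, exists c, exists d,
     (deg G a == deg G b) && swap G a b c d H].

End SimpleGraphs.

(* Main.v *)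
Require Import Defs.
From mathcomp Require Import all_boot all_order all_algebra.
From mathcomp Require Import zify.

(** Colour every vertex by its degree class and let the spectrum of x record how
    many neighbours x has in each class. If a and b lie in one class, a has more
    neighbours than b in class j and fewer in class k, then an RSO at a, b moves
    one neighbour from j to k at a and one from k to j at b, leaving all other
    spectra and all column sums of the spectra (which the joint degree matrix
    determines) unchanged.
    - Such trades decrease the sum of squares until the graph is balanced: within
      a class, each spectrum entry takes only the two values q and q + 1, where q
      depends on the column sums alone.
    - Two balanced graphs are given equal spectra one vertex at a time: if v has
      the excess in class j in G and in class k in H, comparing the excesses in j
      and k over the unfinished vertices tells whether G or H admits a trade at v
      that removes the discrepancy. Working on both sides is harmless because
      RSOs are reversible.
    - Two graphs with equal spectra are given equal neighbourhoods one vertex at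
      a time, by the same comparison applied to the neighbours y (in G only) and
      z (in H only) of the current vertex. *)

Set Implicit Arguments.
Unset Strict Implicit.
Unset Printing Implicit Defensive.

(** * Comparing finite sums, and equality of unordered pairs *)

Lemma ltn_sum_at (I : finType) (P : pred I) (E1 E2 : I -> nat) (j : I) :
  (forall i, P i -> E1 i <= E2 i) -> P j -> E1 j < E2 j ->
  \sum_(i | P i) E1 i < \sum_(i | P i) E2 i.
Proof.
move=> leE Pj ltE; rewrite !(bigD1 j Pj) /= -addSn leq_add //.
by apply: leq_sum => i /andP[/leE].
Qed.

Lemma sum_compensate (I : finType) (P : pred I) (E1 E2 : I -> nat) (j : I) :
  \sum_(i | P i) E2 i <= \sum_(i | P i) E1 i -> P j -> E1 j < E2 j ->
  exists2 i, P i & E2 i < E1 i.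
Proof.
move=> le21 Pj ltj.
case: (pickP [pred i | P i && (E2 i < E1 i)]) => [i /andP[]|no]; first by exists i.
suff: \sum_(i | P i) E1 i < \sum_(i | P i) E2 i by rewrite ltnNge le21.
apply: (ltn_sum_at _ Pj ltj) => i Pi.
by move: (no i); rewrite /= Pi /= ltnNge => /negbFE.
Qed.

Lemma sum_pred1_mul (I : finType) (P : pred I) (a : I) (m : nat) :
  \sum_(i | P i) (i == a) * m = P a * m.
Proof.
rewrite -big_distrl /=; congr (_ * m); rewrite big_mkcond (bigD1 a) //= eqxx.
rewrite big1 ?addn0; first by case: (P a).
by move=> i /negPf ->; case: (P i).
Qed.

Lemma eq_set2 (T : finType) (x y a b : T) :
  ([set x; y] == [set a; b]) =
  (x == a) && (y == b) || (x == b) && (y == a).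
Proof.
apply/eqP/idP => [/setP E|]; last first.
  by case/orP=> /andP[/eqP-> /eqP->] //; rewrite setUC.
move: (E x) (E y) (E a) (E b); rewrite !inE !eqxx /= (eq_sym a x) (eq_sym a y).
rewrite (eq_sym b x) (eq_sym b y) !orbT.
by case: (x == a); case: (x == b); case: (y == a); case: (y == b).
Qed.

(** * Neighbour counts and the effect of a swap on them *)

Section Neighbours.
Variable T : finType.
Implicit Types (G H : sgraph T) (P Q : pred T) (a b c d x y : T).

Lemma adjC G x y : adj G x y = adj G y x.
Proof. by rewrite /adj setUC. Qed.

Lemma adjxx G x : adj G x x = false.
Proof.
apply/negP => xx; move/forallP/(_ [set x; x])/implyP/(_ xx): (edges_card2 G).
by rewrite setUid cards1.
Qed.

Lemma adj_ext G H : (forall x y, adj G x y = adj H x y) -> G = H.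
Proof.
move=> eqGH; apply: val_inj; apply/setP => /= e; apply/idP/idP => eG.
  move/forallP/(_ e)/implyP/(_ eG)/cards2P: (edges_card2 G) => [x [y [_ Ee]]].
  by move: eG (eqGH x y); rewrite /adj -Ee => -> <-.
move/forallP/(_ e)/implyP/(_ eG)/cards2P: (edges_card2 H) => [x [y [_ Ee]]].
by move: eG (eqGH x y); rewrite /adj -Ee => -> ->.
Qed.

Definition nbr G P x := #|[set y | adj G x y && P y]|.

Lemma degE G x : deg G x = nbr G predT x.
Proof. by apply: eq_card => y; rewrite !inE andbT. Qed.

Lemma nbrE G P x : nbr G P x = \sum_(y | P y) adj G x y.
Proof.
rewrite /nbr -sum1dep_card big_mkcond [RHS]big_mkcond; apply: eq_bigr => y _.
by case: (adj G x y); case: (P y).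
Qed.

(* P u = P v makes u and v cancel out of each other's neighbourhood. *)
Lemma private_nbr G P u v :
  P u = P v -> nbr G P u < nbr G P v ->
  exists w, [/\ P w, adj G v w, ~~ adj G u w, w != u & w != v].
Proof.
move=> Puv.
rewrite /nbr (cardsD1 v) (cardsD1 u [set y | adj G v y && P y]) !inE adjC Puv.
rewrite ltn_add2l => lt_uv.
have /subsetPn[w] : ~~ ([set y | adj G v y && P y] :\ u \subset
                        [set y | adj G u y && P y] :\ v).
  by apply/negP => /subset_leq_card; rewrite leqNgt lt_uv.
rewrite !inE => /andP[wu /andP[vw Pw]].
have wv: w != v by apply: contraTneq vw => ->; rewrite adjxx.
by rewrite wv Pw andbT => /= uw; exists w.
Qed.

Lemma swap_exists G a b c d :
  uniq [:: a; b; c; d] ->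
  adj G a c -> adj G b d -> ~~ adj G b c -> ~~ adj G a d ->
  exists G', swap G a b c d G'.
Proof.
move=> un ac bd bc ad.
pose E := (edges G :\: [set [set a; c]; [set b; d]])
             :|: [set [set b; c]; [set a; d]].
have E2 : [forall e in E, #|e| == 2].
  apply/forallP => e; apply/implyP; rewrite !inE.
  move: un; rewrite /= !inE !negb_or => /and4P[/and3P[_ _ nad] /andP[nbc _] _ _].
  case/orP=> [/andP[_ eG]|/orP[/eqP->|/eqP->]]; rewrite ?cards2 ?nbc ?nad //.
  by move/forallP/(_ e)/implyP/(_ eG): (edges_card2 G).
by exists (SGraph E2); rewrite /swap un ac bd bc ad /= eqxx.
Qed.

(* The subtracted terms are moved across, so that both sides stay in nat. *)
Lemma adj_swap G G' a b c d x y : swap G a b c d G' ->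
    adj G' x y + ((x == a) * (y == c) + (x == c) * (y == a)
                + ((x == b) * (y == d) + (x == d) * (y == b)))
  = adj G x y + ((x == b) * (y == c) + (x == c) * (y == b)
                + ((x == a) * (y == d) + (x == d) * (y == a))).
Proof.
case/and5P=> un ac bd bc /andP[ad /eqP eqE].
rewrite {1}/adj eqE !inE !eq_set2 -/(adj G x y).
(* The four vertices are distinct, so [x] and [y] each equal at most one of them, which discards
   most cases below. *)
have le1 z : (z == a) + ((z == b) + ((z == c) + (z == d))) <= 1.
  have := count_uniq_mem z un; rewrite /= !(eq_sym _ z) addn0 => ->.
  exact: leq_b1.
have key u v : (x == u) && (y == v) || (x == v) && (y == u) ->
   adj G x y = adj G u v.
  by case/orP=> /andP[/eqP-> /eqP->] //; rewrite adjC.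
move: (key a c) (key b d) (key b c) (key a d).
rewrite ac bd (negPf bc) (negPf ad).
move: (le1 x) (le1 y) => {key le1}.
case: (x == a); case: (x == b); case: (x == c); case: (x == d) => //= _;
  case: (y == a); case: (y == b); case: (y == c); case: (y == d) => //= _;
  case: (adj G x y) => //= k1 k2 k3 k4;
  by first [have := k1 isT | have := k2 isT | have := k3 isT | have := k4 isT].
Qed.

(** Sum [adj_swap] over [P]: [c] exchanges its neighbour [a] for [b] and [d] exchanges [b] for [a],
    which cancels as [P a = P b]. *)
Lemma nbr_swap G G' P a b c d x : swap G a b c d G' -> P a = P b ->
    nbr G' P x + ((x == a) * P c + (x == b) * P d)
  = nbr G P x + ((x == b) * P c + (x == a) * P d).
Proof.
move=> swG Pab; have sumE u v :
    \sum_(y | P y) ((x == u) * (y == v)) = (x == u) * P v.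
  by under eq_bigr do rewrite mulnC; rewrite sum_pred1_mul mulnC.
have := @eq_bigr _ 0 addn _ (index_enum T) P _ _ (fun y _ => adj_swap x y swG).
rewrite !big_split /= -!nbrE !sumE Pab; lia.
Qed.

Lemma deg_swap G G' a b c d x : swap G a b c d G' -> deg G' x = deg G x.
Proof.
move=> swG; rewrite !degE.
by have := @nbr_swap _ _ predT _ _ _ _ x swG erefl; rewrite /=; lia.
Qed.

(** Exchanging the roles of [c] and [d] undoes the swap. *)
Lemma swapC G G' a b c d : swap G a b c d G' -> swap G' a b d c G.
Proof.
case/and5P=> un ac bd bc /andP[ad /eqP eqE].
have sepE x y u v : adj G x y -> ~~ adj G u v -> [set x; y] != [set u; v].
  by rewrite /adj; case: eqP => // ->  ->.
rewrite /swap.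
have -> : uniq [:: a; b; d; c].
  move: un; rewrite /= !inE !negb_or (eq_sym d c).
  by case/and4P=> /and3P[-> -> ->] /andP[-> ->] ->.
rewrite /adj eqE !inE !eqxx ?orbT /=.
rewrite (negPf (sepE _ _ _ _ ac bc)) (negPf (sepE _ _ _ _ ac ad)).
rewrite (negPf (sepE _ _ _ _ bd bc)) (negPf (sepE _ _ _ _ bd ad)) /=.
apply/eqP/setP => e; rewrite !inE.
have k1 : e == [set a; c] -> e \in edges G by move/eqP->.
have k2 : e == [set b; d] -> e \in edges G by move/eqP->.
have k3 : e == [set b; c] -> e \notin edges G by move/eqP->.
have k4 : e == [set a; d] -> e \notin edges G by move/eqP->.
move: k1 k2 k3 k4; case: (e \in _); case: (e == [set a; c]) => //=;
  case: (e == [set b; d]) => //=; case: (e == [set b; c]) => //=;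
  case: (e == [set a; d]) => //= k1 k2 k3 k4;
  by first [have := k1 isT | have := k2 isT | have := k3 isT | have := k4 isT].
Qed.

Lemma swap_rso G G' a b c d : deg G a = deg G b -> swap G a b c d G' -> rso G G'.
Proof.
move=> dab swG; apply/existsP; exists a; apply/existsP; exists b.
by apply/existsP; exists c; apply/existsP; exists d; rewrite dab eqxx.
Qed.

Lemma rso_sym : symmetric (@rso T).
Proof.
suff sub G G' : rso G G' -> rso G' G by move=> G G'; apply/idP/idP; apply: sub.
case/existsP=> a /existsP[b /existsP[c /existsP[d /andP[/eqP dab swG]]]].
by apply: (swap_rso _ (swapC swG)); rewrite !(deg_swap _ swG).
Qed.

End Neighbours.

(** * Spectra, column sums and trades *)

Section Colouring.
Variables (T K : finType) (f : T -> K) (w : K -> nat).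
Implicit Types (G H : sgraph T) (S : {set T}) (x y z u v : T) (i j k l : K).

Definition spec G x l := nbr G [pred y | f y == l] x.

Definition coloured G := forall x, deg G x = w (f x).

(** Counts ordered adjacent pairs, hence an edge inside a class twice. *)
Definition colsum G i l := \sum_(x | f x == i) spec G x l.

Lemma coloured_swap G G' a b c d :
  coloured G -> swap G a b c d G' -> coloured G'.
Proof. by move=> cG swG x; rewrite (deg_swap _ swG) cG. Qed.

Lemma coloured_rso G G' a b c d :
  coloured G -> f a = f b -> swap G a b c d G' -> rso G G'.
Proof. by move=> cG fab; apply: swap_rso; rewrite !cG fab. Qed.

Lemma sum_spec G x : \sum_l spec G x l = deg G x.
Proof.
rewrite degE nbrE (partition_big f predT) //=.
by apply: eq_bigr => l _; rewrite /spec nbrE; apply: eq_bigl.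
Qed.

Lemma spec_swap G G' a b c d x l : swap G a b c d G' -> f a = f b ->
    spec G' x l + ((x == a) * (f c == l) + (x == b) * (f d == l))
  = spec G x l + ((x == b) * (f c == l) + (x == a) * (f d == l)).
Proof.
by move=> swG fab; apply: (nbr_swap x swG (P := [pred y | f y == l])); rewrite /= fab.
Qed.

Lemma colsum_swap G G' a b c d i l : swap G a b c d G' -> f a = f b ->
  colsum G' i l = colsum G i l.
Proof.
move=> swG fab.
have := @eq_bigr _ 0 addn _ (index_enum T) (fun x => f x == i) _ _
  (fun x _ => spec_swap x l swG fab).
rewrite !big_split /= !sum_pred1_mul fab -!/(colsum _ _ _); lia.
Qed.

(** [private_nbr] gives [c] in class [j] adjacent to [a] but not [b], and [d] in class [k] adjacent
    to [b] but not [a]; the swap uses these. *)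
Lemma trade G a b j k : coloured G -> f a = f b ->
    spec G b j < spec G a j -> spec G a k < spec G b k ->
  exists G', [/\ rso G G', coloured G', colsum G' =2 colsum G &
    forall x l, spec G' x l + ((x == a) * (j == l) + (x == b) * (k == l))
              = spec G x l + ((x == b) * (j == l) + (x == a) * (k == l))].
Proof.
move=> cG fab ltj ltk.
have [|c [/eqP fc ac bc cb ca]] := private_nbr _ ltj; first by rewrite /= fab.
have [|d [/eqP fd bd ad da db]] := private_nbr _ ltk; first by rewrite /= fab.
have un : uniq [:: a; b; c; d].
  rewrite /= !inE !negb_or !(eq_sym a) !(eq_sym b) cb ca da db !andbT /=.
  apply/andP; split; first by apply: contraTneq ltj => ->; rewrite ltnn.
  by apply: contraNneq ad => <-.
have [G' swG] := swap_exists un ac bd bc ad.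
exists G'; split=> [||i l|x l].
- exact: coloured_rso swG.
- exact: coloured_swap swG.
- exact: colsum_swap swG fab.
- by rewrite -fc -fd; apply: spec_swap swG fab.
Qed.

(** * Connecting graphs with equal spectra *)

(** Since [x] counts for [y] only, [z] has more neighbours than [y] in [P] apart from [x]. One of
    them, [t], is not adjacent to [y] and allows the swap [xy, tz => ty, xz]. Spectra persist
    because [y] and [z] share a colour. *)
Lemma match_edge G S x y z :
    let P := [pred u | (f u == f x) && (u \notin S)] in
    coloured G -> x \notin S -> y \notin S -> z \notin S -> f y = f z ->
    z != x -> adj G x y -> ~~ adj G x z -> nbr G P y <= nbr G P z ->
  exists G', [/\ rso G G', coloured G', spec G' =2 spec G,
    forall u v, u \in S -> adj G' u v = adj G u v &
    forall v, adj G' x v + (v == y) = adj G x v + (v == z)].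
Proof.
move=> P cG xS yS zS fyz zx xy xz leP.
have yx : y != x by apply: contraTneq xy => ->; rewrite adjxx.
have yz : y != z by apply: contraTneq xy => ->.
pose Q := [pred u | P u && (u != x)].
have nbrQ v : nbr G P v = adj G v x + nbr G Q v.
  rewrite /nbr (cardsD1 x) !inE eqxx xS !andbT; congr (_ + _).
  by apply: eq_card => u; rewrite !inE andbC -!andbA.
have Qyz : Q y = Q z by rewrite /= fyz yS zS yx zx.
have [|t [/andP[/andP[/eqP ft tS] tx] zt yt ty tz]] := private_nbr (G := G) Qyz.
  by move: leP; rewrite !nbrQ !(adjC _ _ x) xy (negPf xz).
have un : uniq [:: x; t; y; z].
  by rewrite /= !inE !negb_or !(eq_sym x) tx yx zx ty tz yz.
have [G' swG] : exists G', swap G x t y z G'.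
  by apply: swap_exists; rewrite // adjC.
have fxt : f x = f t by [].
exists G'; split=> [|||u v uS|v].
- exact: coloured_rso swG.
- exact: coloured_swap swG.
- move=> u l; have := spec_swap u l swG fxt.
  by rewrite fyz addnC [RHS]addnC [X in X + _]addnC => /addnI.
- have uN v' : v' \notin S -> (u == v') = false by apply: contraNF => /eqP <-.
  have := adj_swap u v swG; rewrite !uN //= !addn0.
  by case: (adj G u v); case: (adj G' u v).
- have := adj_swap x v swG; rewrite eqxx !(eq_sym x) (negPf yx) (negPf zx).
  by rewrite (negPf tx) /= !mul1n !addn0 !add0n.
Qed.

Lemma connect_same_spec G H : coloured G -> coloured H -> spec G =2 spec H ->
  connect (@rso T) G H.
Proof.
have csym := sym_connect_sym (@rso_sym T).
(* [S] collects the finished vertices, whose neighbourhoods already agree. *)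
suff main n : forall S G H, #|~: S| <= n -> coloured G -> coloured H ->
    spec G =2 spec H -> (forall u v, u \in S -> adj G u v = adj H u v) ->
    connect (@rso T) G H.
  by move=> cG cH sGH; apply: (main #|~: set0| set0) => // u v; rewrite inE.
elim: n => [|n IHn] S {}G {}H leS cG cH sGH eqS.
  have -> : G = H; last exact: connect0.
  apply: adj_ext => u v; apply: eqS; apply: contraTT leS => uS.
  by rewrite -ltnNge (cardD1 u) !inE uS.
case: (pickP [pred x | x \notin S]) => [x /= xS|allS]; last first.
  have -> : G = H; last exact: connect0.
  by apply: adj_ext => u v; apply: eqS; move: (allS u) => /= /negbFE.
pose dif G H := [set y | adj G x y && ~~ adj H x y].
have [m] := ubnP #|dif G H|; elim: m G H cG cH sGH eqS => // m IHm G H cG cH sGH eqS.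
rewrite ltnS => lem.
have degGH u : nbr G predT u = nbr H predT u by rewrite -!degE cG cH.
case: (pickP [pred y | y \in dif G H]) => [y /= | dif0]; last first.
  apply: (IHn (x |: S)) => //.
    rewrite -ltnS (leq_trans _ leS) // proper_card //.
    apply/properP; split; first by rewrite setCS subsetUr.
    by exists x; rewrite !inE ?eqxx.
  move=> u v; rewrite !inE => /orP[/eqP->|/eqS->//].
  (* Equal degrees turn this inclusion into equality. *)
  have sub : [set y | adj G x y && predT y] \subset [set y | adj H x y && predT y].
    apply/subsetP => y; rewrite !inE !andbT => xy.
    by move: (dif0 y); rewrite /= inE xy => /negbFE.
  have /eqP/setP/(_ v) : [set y | adj G x y && predT y] == [set y | adj H x y && predT y].
    by rewrite eqEcard sub /=; move: (degGH x); rewrite /nbr => ->.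
  by rewrite !inE !andbT.
rewrite inE => /andP[xyG xyH].
(* [x] has equally many neighbours of colour [f y] in both graphs, so some [z] offsets [y]. *)
have [z /eqP fz] : exists2 z, f z == f y & adj G x z < adj H x z.
  have := sGH x (f y); rewrite /spec !nbrE => eqs.
  by apply: (sum_compensate (j := y)); rewrite ?eqs //= xyG (negPf xyH).
case xzG: (adj G x z); case xzH: (adj H x z) => // _.
have xNS v : adj G x v != adj H x v -> v \notin S.
  by apply: contraNN => vS; rewrite !(adjC _ x) eqS.
have yS : y \notin S by apply: xNS; rewrite xyG (negPf xyH).
have zS : z \notin S by apply: xNS; rewrite xzG xzH.
have zx : z != x by apply: contraTneq xzH => ->; rewrite adjxx.
have yx : y != x by apply: contraTneq xyG => ->; rewrite adjxx.
have fyz : f y = f z by [].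
pose P := [pred u | (f u == f x) && (u \notin S)].
(* The spectra agree, and so do the contributions from [S]. *)
have nbrGH v : nbr G P v = nbr H P v.
  pose R := [pred u | (f u == f x) && (u \in S)].
  have split G1 : spec G1 v (f x) = nbr G1 R v + nbr G1 P v.
    rewrite /spec !nbrE (bigID (mem S)) /=.
    by congr (_ + _); apply: eq_bigl => u; rewrite inE.
  have := sGH v (f x); rewrite !split; suff -> : nbr G R v = nbr H R v by lia.
  rewrite !nbrE; apply: eq_bigr => u /andP[_ uS].
  by rewrite adjC eqS // adjC.
(* Whichever of y and z has the larger count outside S decides whether the
   exchange is done in G or in H. *)
case: (leqP (nbr G P y) (nbr G P z)) => [le_yz|/ltnW le_zy].
  have [|G' [rGG' cG' sG' eqS' adjx]] :=
    match_edge cG xS yS zS fyz zx xyG _ le_yz; first by rewrite xzG.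
  apply: (connect_trans (connect1 rGG')); apply: IHm => //.
  - by move=> u l; rewrite sG'.
  - by move=> u v uS; rewrite eqS' ?eqS.
  apply: leq_trans lem; apply: proper_card; apply/properP; split.
    apply/subsetP => v; rewrite !inE; move: (adjx v).
    case: (eqVneq v z) => [->|_]; first by rewrite xzH andbF.
    by case: (adj G' x v); case: (adj G x v) => //; case: (v == y).
  exists y; rewrite !inE ?xyG //; move: (adjx y); rewrite eqxx xyG.
  by case: (eqVneq y z) xzG => [<-|_ _]; [rewrite xyG|case: (adj G' x y)].
(* In [H] the roles of [y] and [z] are exchanged: the edge [xz] gives way to [xy]. *)
have le_zy' : nbr H P z <= nbr H P y by rewrite -!nbrGH.
have [H' [rHH' cH' sH' eqS' adjx]] :=
  match_edge cH xS zS yS (esym fyz) yx xzH xyH le_zy'.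
rewrite csym; apply: (connect_trans (connect1 rHH')); rewrite csym.
apply: IHm => //.
- by move=> u l; rewrite sH'.
- by move=> u v uS; rewrite eqS' ?eqS.
apply: leq_trans lem; apply: proper_card; apply/properP; split.
  apply/subsetP => v; rewrite !inE; move: (adjx v).
  case: (eqVneq v z) => [->|_]; first by rewrite xzG.
  by case: (adj H' x v); case: (adj H x v) => //; case: (v == y); rewrite ?andbF.
exists y; rewrite !inE ?xyG //; move: (adjx y); rewrite eqxx (negPf xyH).
by case: (eqVneq y z) xzG => [<-|_ _]; [rewrite xyG|case: (adj H' x y)].
Qed.

(** * Balancing one graph *)

Definition balanced G := forall x y l, f x = f y -> spec G x l <= (spec G y l).+1.

Lemma balance G : coloured G ->
  exists G', [/\ connect (@rso T) G G', coloured G', colsum G' =2 colsum G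
                & balanced G'].
Proof.
pose sq G := \sum_l \sum_x spec G x l ^ 2.
have [m] := ubnP (sq G); elim: m G => // m IHm G; rewrite ltnS => lem cG.
case: (pickP [pred p : T * T * K | (f p.1.1 == f p.1.2) &&
         ((spec G p.1.2 p.2).+1 < spec G p.1.1 p.2)]) => [[[a b] j]|nop]; last first.
  exists G; split=> // x y l fxy; move: (nop (x, y, l)) => /=.
  by rewrite fxy eqxx /= ltnNge => /negbFE.
case/andP=> /= /eqP fab ltj.
(* Equal degrees force a class in which [b] is ahead. *)
have [k _ ltk] : exists2 k, predT k & spec G a k < spec G b k.
  by apply: (sum_compensate (j := j)); rewrite ?sum_spec ?cG ?fab // ltnW.
have [G' [rGG' cG' colG' specG']] := trade cG fab (ltnW ltj) ltk.
have ab : a != b by apply: contraTneq ltk => ->; rewrite ltnn.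
have jk : j != k by apply: contraTneq ltk => <-; rewrite -leqNgt; lia.
(* Moving one unit across a gap [d] changes the sum of squares by [2 - 2 * d]: negative in class
   [j], where [d >= 2], and at most zero in class [k], where [d >= 1]. *)
have ltG' l : \sum_x spec G' x l ^ 2 + (l == j) <= \sum_x spec G x l ^ 2.
  have eqx x : x != a -> x != b -> spec G' x l = spec G x l.
    by move=> xa xb; have := specG' x l; rewrite (negPf xa) (negPf xb) /= !addn0.
  have split2 (F : T -> nat) :
      \sum_x F x = F a + F b + \sum_(x | (x != a) && (x != b)) F x.
    by rewrite (bigD1 a) //= (bigD1 b) 1?eq_sym //= addnA.
  rewrite !split2 (eq_bigr (fun x => spec G x l ^ 2)) =>
    [|x /andP[xa xb]]; last by rewrite eqx.
  have := specG' a l; have := specG' b l.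
  rewrite !eqxx (eq_sym b) (negPf ab) (eq_sym l) /= -!mulnn.
  case: (eqVneq j l) => [<-|_].
    by rewrite (eq_sym k) (negPf jk) /=; nia.
  by case: (eqVneq k l) => [<-|_] /=; nia.
have [||G1 [conn1 cG1 col1 bal1]] := IHm G' => //.
  apply: leq_trans lem; apply: (ltn_sum_at (j := j)) => // [l _|].
    by apply: leq_trans (ltG' l); apply: leq_addr.
  by have := ltG' j; rewrite eqxx addn1.
exists G1; split=> //; first exact: connect_trans (connect1 rGG') conn1.
by move=> i l; rewrite col1 colG'.
Qed.

(** * Connecting two balanced graphs *)

Definition spec_within (q : K -> K -> nat) G :=
  forall x l, q (f x) l <= spec G x l <= (q (f x) l).+1.

(** Entries of a class that differ by at most one are the floor of their average or one more. *)
Lemma balanced_within G : balanced G ->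
  spec_within (fun i l => colsum G i l %/ #|[pred x | f x == i]|) G.
Proof.
move=> balG x l.
have n0 : 0 < #|[pred y | f y == f x]|.
  by apply/card_gt0P; exists x; rewrite inE /=.
apply/andP; split.
  rewrite -ltnS ltn_divLR // mulnC -sum_nat_const.
  (* The term at [x] itself makes the bound strict. *)
  apply: (ltn_sum_at (j := x)) => // y /eqP fy.
  exact: balG.
(* For a zero entry the predecessor is zero and the bound is trivial. *)
have : (spec G x l).-1 <= colsum G (f x) l %/ #|[pred y | f y == f x]|; last lia.
rewrite leq_divRL // mulnC -sum_nat_const; apply: leq_sum => y /eqP fy.
by have := balG x y l (esym fy); lia.
Qed.

(** All excesses over [q] are 0 or 1. As [v] has excess in [j] only, the comparison of totals yields
    [v'] outside [S] with excess in [k] only; trading between them keeps every entry within [q] and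
    [q + 1]. *)
Lemma match_spec q G S v j k :
    let P := [pred x | (f x == f v) && (x \notin S)] in
    coloured G -> spec_within q G -> v \notin S ->
    spec G v j = (q (f v) j).+1 -> spec G v k = q (f v) k ->
    \sum_(x | P x) (spec G x j - q (f v) j)
      <= \sum_(x | P x) (spec G x k - q (f v) k) ->
  exists G', [/\ rso G G', coloured G' /\ colsum G' =2 colsum G,
    spec_within q G', forall u l, u \in S -> spec G' u l = spec G u l &
    forall l, spec G' v l + (j == l) = spec G v l + (k == l)].
Proof.
move=> P cG inq vS vj vk leP.
have [||v' /andP[/eqP fv' v'S] lt'] := sum_compensate leP (j := v).
- by rewrite /= eqxx.
- by rewrite vj vk subnn subSnn.
have := inq v' j; have := inq v' k; rewrite fv' => ink inj.
have [||G' [rGG' cG' colG' specG']] := trade cG (esym fv') (j := j) (k := k).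
- by lia.
- by lia.
have vv' : v != v' by apply: contraTneq lt' => <-; rewrite vj vk; lia.
exists G'; split=> // [x l|u l uS|l].
- have := inq x l; have := specG' x l.
  case: (eqVneq x v) => [->|xv].
    rewrite (negPf vv') /=.
    case: (eqVneq j l) => [<-|_]; last by case: (eqVneq k l) => [<-|_] /=; lia.
    by case: (eqVneq k j) => [eq_kj|_] /=; lia.
  case: (eqVneq x v') => [->|xv']; last by rewrite /=; lia.
  rewrite fv' /=.
  case: (eqVneq j l) => [<-|_]; last by case: (eqVneq k l) => [<-|_] /=; lia.
  by case: (eqVneq k j) => [eq_kj|_] /=; lia.
- have uN x : x \notin S -> (u == x) = false by apply: contraNF => /eqP <-.
  by have := specG' u l; rewrite !uN //=; lia.
- by have := specG' v l; rewrite eqxx (negPf vv'); lia.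
Qed.

Lemma connect_spec_within q G H : coloured G -> coloured H ->
    colsum G =2 colsum H -> spec_within q G -> spec_within q H ->
  connect (@rso T) G H.
Proof.
have csym := sym_connect_sym (@rso_sym T).
(* [S] collects the vertices whose spectra already agree. *)
suff main n : forall S G H, #|~: S| <= n -> coloured G -> coloured H ->
    colsum G =2 colsum H -> spec_within q G -> spec_within q H ->
    (forall u l, u \in S -> spec G u l = spec H u l) ->
    connect (@rso T) G H.
  move=> cG cH colGH qG qH; apply: (main #|~: set0| set0) => // u v.
  by rewrite inE.
elim: n => [|n IHn] S {}G {}H leS cG cH colGH qG qH eqS.
  apply: connect_same_spec => // u l; apply: eqS; apply: contraTT leS => uS.
  by rewrite -ltnNge (cardD1 u) !inE uS.
case: (pickP [pred x | x \notin S]) => [v /= vS|allS]; last first.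
  apply: connect_same_spec => // u l.
  by apply: eqS; move: (allS u) => /= /negbFE.
pose dif G H := [set l | spec G v l != spec H v l].
have [m] := ubnP #|dif G H|.
elim: m G H cG cH colGH qG qH eqS => // m IHm G H cG cH colGH qG qH eqS.
rewrite ltnS => lem.
case: (pickP [pred l | l \in dif G H]) => [l0 /= | dif0]; last first.
  apply: (IHn (v |: S)) => //.
    rewrite -ltnS (leq_trans _ leS) // proper_card //.
    apply/properP; split; first by rewrite setCS subsetUr.
    by exists v; rewrite !inE ?eqxx.
  move=> u l; rewrite !inE => /orP[/eqP->|/eqS->//].
  by move: (dif0 l); rewrite /= inE => /negbFE/eqP.
rewrite inE => l0P.
have sumGH : \sum_l spec G v l = \sum_l spec H v l by rewrite !sum_spec cG cH.
have [j ltj] : exists j, spec H v j < spec G v j.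
  case: (ltngtP (spec H v l0) (spec G v l0)) l0P => [lt _|gt _|//].
    by exists l0.
  by have [||j] := sum_compensate (P := predT) _ _ gt; rewrite ?sumGH //; exists j.
have [||k _ ltk] := sum_compensate (P := predT) _ _ ltj; rewrite ?sumGH //.
(* Hence [v] has excess in [j] but not [k] in [G], and in [k] but not [j] in [H]. *)
have := qG v j; have := qG v k; have := qH v j; have := qH v k.
move=> qHk qHj qGk qGj.
pose P := [pred x | (f x == f v) && (x \notin S)].
(* Column sums agree and vertices in [S] contribute equally, so the excess totals outside [S]
   agree. *)
have sumP l : \sum_(x | P x) (spec G x l - q (f v) l)
            = \sum_(x | P x) (spec H x l - q (f v) l).
  have subE G1 : spec_within q G1 -> \sum_(x | P x) (spec G1 x l - q (f v) l)
      = \sum_(x | P x) spec G1 x l - \sum_(x | P x) q (f v) l.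
    move=> qG1; rewrite sumnB // => x /andP[/eqP fx _].
    by have := qG1 x l; rewrite fx => /andP[].
  rewrite !subE //; congr (_ - _); have := colGH (f v) l.
  rewrite /colsum (bigID (mem S)) [in RHS](bigID (mem S)) /=.
  by rewrite (eq_bigr (spec H^~ l)) => [/addnI|x /andP[_ /eqS]].
have jk : j != k by apply: contraTneq ltj => ->; rewrite -leqNgt ltnW.
(* The gaps at [j] and [k] are exactly one, so a trade in either graph closes both and opens no
   other. *)
have decr G1 H1 :
    (forall l, spec G1 v l + (j == l) = spec G v l + (k == l) /\ H1 = H \/
               spec H1 v l + (k == l) = spec H v l + (j == l) /\ G1 = G) ->
    #|dif G1 H1| < m.
  move=> adv; apply: leq_trans lem; apply: proper_card; apply/properP; split.
    apply/subsetP => l; rewrite !inE; move: (adv l).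
    case: (eqVneq j l) => [<-|_]; last by
      case: (eqVneq k l) => [<-|_]; move=> [] [/= e ->]; lia.
    by rewrite (eq_sym k) (negPf jk) => -[] [/= e ->]; lia.
  exists j; rewrite !inE; first by lia.
  by move: (adv j); rewrite eqxx eq_sym (negPf jk) => -[] [/= e ->]; lia.
(* The trade is made in [G] if the total for [j] is at most that for [k], otherwise in [H]. *)
case: (leqP (\sum_(x | P x) (spec G x j - q (f v) j))
            (\sum_(x | P x) (spec G x k - q (f v) k))) => [le_jk|/ltnW le_kj].
  have [||G' [rGG' [cG' colG'] qG' eqS' adv]] := match_spec cG qG vS _ _ le_jk.
  - by lia.
  - by lia.
  apply: (connect_trans (connect1 rGG')); apply: IHm => //.
  - by move=> i l; rewrite colG'.
  - by move=> u l uS; rewrite eqS' ?eqS.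
  - by apply: decr => l; left.
have {}le_kj : \sum_(x | P x) (spec H x k - q (f v) k)
            <= \sum_(x | P x) (spec H x j - q (f v) j) by rewrite -!sumP.
have [||H' [rHH' [cH' colH'] qH' eqS' adv]] := match_spec cH qH vS _ _ le_kj.
- by lia.
- by lia.
rewrite csym; apply: (connect_trans (connect1 rHH')); rewrite csym.
apply: IHm => //.
- by move=> i l; rewrite colH'.
- by move=> u l uS; rewrite eqS' ?eqS.
- by apply: decr => l; right.
Qed.

Lemma connect_colsum G H : coloured G -> coloured H -> colsum G =2 colsum H ->
  connect (@rso T) G H.
Proof.
move=> cG cH colGH.
have [G' [GG' cG' colG' /balanced_within qG']] := balance cG.
have [H' [HH' cH' colH' /balanced_within qH']] := balance cH.
apply: connect_trans GG' _; rewrite (sym_connect_sym (@rso_sym T)).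
apply: connect_trans HH' _.
(* Equal column sums give both balanced graphs the same [q]. *)
apply: (connect_spec_within (q := fun i l => colsum G i l %/ #|[pred x | f x == i]|)).
- by [].
- by [].
- by move=> i l; rewrite colG' colH' colGH.
- by move=> x l; have := qH' x l; rewrite colH' colGH.
- by move=> x l; have := qG' x l; rewrite colG'.
Qed.

End Colouring.

(** * From the joint degree matrix to column sums *)

(** Ordered pairs are grouped by their edge: an edge arises from both orientations when [i = l] and
    from one otherwise. *)
Lemma colsum_jdm (T : finType) (Delta : nat) (f : T -> 'I_Delta) (G : sgraph T)
    (i l : 'I_Delta) :
  coloured f (fun i => i.+1) G -> colsum f G i l = jdm Delta G i l * (i == l).+1.
Proof.
move=> cG.
have clE x k : (x \in deg_class G (nat_of_ord k).+1) = (f x == k).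
  by rewrite inE cG eqSS.
rewrite mxE -sum_nat_const; set A := [set e in edges G | _].
have -> : colsum f G i l =
    \sum_(p : T * T | [&& f p.1 == i, f p.2 == l & adj G p.1 p.2]) 1.
  rewrite /colsum; under eq_bigr do rewrite /spec nbrE.
  rewrite pair_big /= [LHS]big_mkcond [RHS]big_mkcond.
  apply: eq_bigr => -[x y] _ /=.
  by case: (f x == i); case: (f y == l); case: (adj G x y).
rewrite (partition_big (fun p => [set p.1; p.2]) (mem A)) /=; last first.
  move=> [x y] /= /and3P[fx fy xy]; rewrite inE; apply/andP; split=> //.
  by apply/existsP; exists x; apply/existsP; exists y; rewrite !clE fx fy eqxx.
apply: eq_bigr => e; rewrite inE => /andP[eG /existsP[x /existsP[y]]].
rewrite !clE => /and3P[/eqP ee /eqP fx /eqP fy]; subst e.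
have xy : x != y by apply: contraTneq eG => ->; rewrite -/(adj G y y) adjxx.
rewrite sum1dep_card.
have -> : [set p | [&& f p.1 == i, f p.2 == l & adj G p.1 p.2]
                     && ([set p.1; p.2] == [set x; y])]
        = (x, y) |: (if i == l then [set (y, x)] else set0).
  apply/setP => -[u v]; rewrite !inE eq_set2 xpair_eqE.
  have -> : ((u, v) \in (if i == l then [set (y, x)] else set0))
          = [&& i == l, u == y & v == x].
    by case: (i == l); rewrite !inE.
  case: (eqVneq u x) => [->|_]; case: (eqVneq v y) => [->|_] /=.
  - by rewrite fx fy !eqxx /= -[adj _ _ _]/(_ \in _) eG.
  - by rewrite (negPf xy) !andbF.
  - by rewrite (eq_sym y) (negPf xy) !andbF.
  case: (eqVneq u y) => [->|_]; case: (eqVneq v x) => [->|_] /=; rewrite ?andbF //.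
  by rewrite fx fy (eq_sym l) adjC -[adj _ _ _]/(_ \in _) eG; case: (i == l).
rewrite cardsU1; case: (i == l); rewrite ?cards0 ?cards1 ?inE //.
by rewrite xpair_eqE (negPf xy).
Qed.

(* V i is the degree class V_{i+1}; classes may be empty. *)
Theorem theorem3 (T : finType) (Delta : nat) (V : 'I_Delta -> {set T})
    (V_disjoint : forall i j : 'I_Delta, i != j -> [disjoint V i & V j])
    (V_cover : \bigcup_(i < Delta) V i = [set: T])
    (G H : sgraph T)
    (G_no_isolated : forall x : T, 0 < deg G x)
    (H_no_isolated : forall x : T, 0 < deg H x)
    (G_deg : forall i : 'I_Delta, deg_class G i.+1 = V i)
    (H_deg : forall i : 'I_Delta, deg_class H i.+1 = V i)
    (eq_jdm : jdm Delta G = jdm Delta H) :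
  exists s : seq (sgraph T), path (@rso T) G s /\ last G s = H.
Proof.
(* The class of each vertex is chosen as data, to serve as its colour. *)
have inV x : {i : 'I_Delta | x \in V i}.
  apply: sigW; have : x \in \bigcup_(i < Delta) V i by rewrite V_cover.
  by case/bigcupP=> i _ xi; exists i.
pose f x := sval (inV x).
have cG : coloured f (fun i => i.+1) G.
  by move=> x; have := svalP (inV x); rewrite -G_deg inE => /eqP.
have cH : coloured f (fun i => i.+1) H.
  by move=> x; have := svalP (inV x); rewrite -H_deg inE => /eqP.
have /connectP[s pathGs lastGs] : connect (@rso T) G H.
  by apply: (connect_colsum cG cH) => i l; rewrite !colsum_jdm ?eq_jdm.
by exists s.
Qed.
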